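(* Let $K$ be an algebraic extension of $\mathbb{Q}$, and let $R$ be a Dedekind domain with quotient field $K$. If $G(R)$ is homeomorphic to $G(\mathbb{Z})$, then $R=\mathbb{Z}$.
   Context: A Dedekind domain is a one-dimensional Noetherian integrally closed domain. For an integral domain $R$, set $R^\bullet:=R\setminus\{0\}$. The Golomb space $G(R)$ is the set $R^\bullet$ endowed with the topology generated by the cosets $a+I$, where $a\in R$ and $I$ is a nonzero ideal of $R$ such that $\langle a,I\rangle=R$. *)

(* Defs.v *)
From HB Require Import structures.
From mathcomp Require Import all_boot all_order all_algebra.
From mathcomp Require Import all_classical all_reals all_analysis.

Set Implicit Arguments.
Unset Strict Implicit.
Unset Printing Implicit Defensive.

Import GRing.Theory.
Local Open Scope classical_set_scope.
Local Open Scope ring_scope.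

(* The library's [idealr_closed] only covers proper ideals; here the whole
   ring counts as an ideal. *)
Definition is_ideal (R : comNzRingType) (I : set R) : Prop :=
  [/\ I 0, (forall x y, I x -> I y -> I (x + y)) & forall a x, I x -> I (a * x)].

Definition ideal_gen (R : comNzRingType) (A : set R) : set R :=
  smallest (@is_ideal R) A.

Definition is_prime_ideal (R : comNzRingType) (P : set R) : Prop :=
  [/\ is_ideal P, P != setT & forall x y, P (x * y) -> P x \/ P y].

Definition noetherian (R : comNzRingType) : Prop :=
  forall I : set R, is_ideal I -> exists s : seq R, I = ideal_gen [set` s].

(* P 0 < P 1 < ... < P n, a chain of length n; later values are irrelevant. *)
Definition prime_chain (R : comNzRingType) (n : nat) (P : nat -> set R) : Prop :=
  (forall i, (i <= n)%N -> is_prime_ideal (P i)) /\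
  (forall i, (i < n)%N -> P i `<` P i.+1).

Definition has_krull_dim (R : comNzRingType) (n : nat) : Prop :=
  (exists P, @prime_chain R n P) /\
  (forall m P, @prime_chain R m P -> (m <= n)%N).

Definition integrally_closed (R : idomainType) : Prop :=
  forall x : {fraction R},
    integralOver (@tofrac R) x -> exists r : R, x = tofrac r.

(* Fields are excluded, their Krull dimension being 0. *)
Definition dedekind_domain (R : idomainType) : Prop :=
  [/\ has_krull_dim R 1, noetherian R & integrally_closed R].

(* The Golomb space: nonzero elements of R, under the topology with subbase
   the cosets a + I with I a nonzero ideal and <a, I> = R.  If 0 is in a + I
   then I = R, so intersecting with the nonzero elements only affects the
   coset a + R. *)
Definition golomb (R : idomainType) : Type := {x : R | x != 0}.

Definition golomb_coset (R : idomainType) (a : R) (I : set R) :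
    set (golomb R) :=
  [set x | exists2 i, I i & \val x = a + i].

Definition golomb_subbase (R : idomainType) : set (set (golomb R)) :=
  [set U | exists a (I : set R),
    [/\ is_ideal I, I != [set 0], ideal_gen (a |` I) = setT &
        U = golomb_coset a I]].

HB.instance Definition _ (R : idomainType) := Choice.on (golomb R).
HB.instance Definition _ (R : idomainType) :=
  isSubBaseTopological.Build (golomb R) (@golomb_subbase R) id.

Definition homeomorphic (X Y : topologicalType) : Prop :=
  exists (f : X -> Y) (g : Y -> X),
    [/\ continuous f, continuous g, cancel f g & cancel g f].

(* Main.v *)
Require Import Defs.
From HB Require Import structures.
From mathcomp Require Import all_boot all_order all_algebra.
From mathcomp Require Import all_classical all_reals all_analysis.
From mathcomp Require Import cyclic ring zify.

(** The Golomb topology of R remembers coprimality, divisibility up to radicals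
    and, for a non-unit d, the d-adic topology on the elements coprime to d.
    Facts about Z are carried to R through this dictionary, until every nonzero
    element of R is seen to be a product of prime numbers up to sign.

    The dictionary.  A point z lies in the closure of a + bR as soon as it is
    congruent to a modulo the primary components of b at the primes that do not
    contain z.  Let F(x,y) be the filter generated by the intersections of a
    closed neighbourhood of x with one of y [closure_filter].  If x <> y and d
    is coprime to both, then x and y are separated by a power of d, so a point
    close in this sense to both has to lie in every prime containing d;
    conversely, the radical of d belongs to F(x,y) only if d is coprime to x
    and y [radical_closure_filter, closure_filter_radical].  Therefore the
    units are the points x for which some F(x,y) is the largest of all these
    filters, and for a unit u the inclusion of F(u,y) in F(u,x) says that x
    divides a power of y.  A homeomorphism thus preserves units, radical
    divisibility and coprimality.  Moreover a subset of the elements coprime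
    to d that is clopen there is open for the d-adic topology
    [clopen_coprime_adic].  The ring-theoretic input is that 2 is nonzero and
    that quotients by nonzero elements have dimension zero, in the elementwise
    form [pi_regular_quotients].

    The argument.  Let h be a homeomorphism from G(R) to G(Z).  The units of R
    are 1 and -1.  Fix a prime number p, put m = |h(p)|, take a prime number l
    not dividing m, and let x be the preimage of l.  Every element of R is
    coprime to x or has a power divisible by x; in a Noetherian integrally
    closed domain with units 1 and -1 it follows that the divisors of the
    powers of x are the elements +- t^j for a single t [radical_atom_powers].
    In Z the powers of l are m-adically dense in a neighbourhood of 1, however
    many prime factors m has [powers_adic_neighborhood].  Transported to R,
    this says that every element of some 1 + p^k R is a p-adic limit of
    elements +- t^j.  For e at least k, the quotient of 1 + p^e R modulo
    1 + p^(2e) R is isomorphic to the additive group R / p^e R, and now its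
    squares are powers of one element; this forces R = Z + pR
    [adic_powers_residues].

    So every prime number p generates a prime ideal of R, with residue field
    of p elements.  A nonzero r in R is algebraic over Q, hence divides a
    nonzero integer c; removing the prime factors of c one at a time from r or
    from c / r shows that r is an integer [divisors_of_integers]. *)

Local Open Scope classical_set_scope.
Local Open Scope ring_scope.

Set Implicit Arguments.
Unset Strict Implicit.
Import GRing.Theory.

(** * Divisibility and coprimality *)

Definition divides (R : comNzRingType) (x y : R) := exists r, y = x * r.

Definition comax (R : comNzRingType) (x y : R) := exists r s, x * r + y * s = 1.

Definition rad_divides (R : comNzRingType) (x y : R) :=
  exists k, divides x (y ^+ k).

(** Quotients by nonzero elements are pi-regular rings, that is, commutative
    rings of Krull dimension zero.  This replaces the Chinese remainder theorem:
    modulo c, a power of b t is an idempotent which vanishes at the primes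
    containing b and is 1 at the others. *)
Definition pi_regular_quotients (R : comNzRingType) :=
  forall b c : R, c != 0 -> exists i t, divides c (b ^+ i * (1 - b * t)).

Section Divisibility.
Variable R : comNzRingType.
Implicit Types a b c d e x y z t : R.

Lemma divides_refl x : divides x x.
Proof. by exists 1; rewrite mulr1. Qed.

Lemma divides_trans y x z : divides x y -> divides y z -> divides x z.
Proof. by move=> [r ->] [s ->]; exists (r * s); rewrite mulrA. Qed.

Lemma divides_mulr x y z : divides x y -> divides x (y * z).
Proof. by move=> [r ->]; exists (r * z); rewrite mulrA. Qed.

Lemma divides_mull x y z : divides x y -> divides x (z * y).
Proof. by rewrite mulrC; exact: divides_mulr. Qed.

Lemma divides_add x y z : divides x y -> divides x z -> divides x (y + z).
Proof. by move=> [r ->] [s ->]; exists (r + s); rewrite mulrDr. Qed.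

Lemma divides_opp x y : divides x y -> divides x (- y).
Proof. by move=> [r ->]; exists (- r); rewrite mulrN. Qed.

Lemma divides_sub x y z : divides x y -> divides x z -> divides x (y - z).
Proof. by move=> xy /divides_opp; exact: divides_add. Qed.

Lemma divides_subC x y z : divides x (y - z) -> divides x (z - y).
Proof. by move/divides_opp; rewrite opprB. Qed.

Lemma divides_sub_trans x a b c :
  divides x (a - b) -> divides x (b - c) -> divides x (a - c).
Proof.
by move=> ab bc; have := divides_add ab bc; rewrite addrA subrK.
Qed.

Lemma divides_exp x y n : divides x y -> divides (x ^+ n) (y ^+ n).
Proof. by move=> [r ->]; exists (r ^+ n); rewrite exprMn. Qed.

Lemma divides_sum x n (F : nat -> R) :
  (forall i, (i < n)%N -> divides x (F i)) -> divides x (\sum_(i < n) F i).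
Proof.
move=> xF; elim/big_ind: _ => [|y z|i _]; [|exact: divides_add|exact: xF].
by exists 0; rewrite mulr0.
Qed.

Lemma divides_pow_le x m n : (m <= n)%N -> divides (x ^+ m) (x ^+ n).
Proof. by move=> mn; exists (x ^+ (n - m)); rewrite -exprD subnKC. Qed.

Lemma divides_subX x y z n : divides x (y - z) -> divides x (y ^+ n - z ^+ n).
Proof. by rewrite subrXX; exact: divides_mulr. Qed.

Lemma divides_1subX x n : divides (1 - x) (1 - x ^+ n).
Proof. by rewrite -{2}(expr1n _ n); apply: divides_subX; exact: divides_refl. Qed.

Lemma comaxC x y : comax x y -> comax y x.
Proof. by move=> [r [s e]]; exists s, r; rewrite addrC. Qed.

Lemma comax_divl x y z : divides x y -> comax y z -> comax x z.
Proof. by move=> [r ->] [s [t e]]; exists (r * s), t; rewrite mulrA. Qed.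

Lemma comax_mul x y z : comax x y -> comax x z -> comax x (y * z).
Proof.
move=> [r [s e]] [r' [s' e']].
exists (r * (x * r' + z * s') + y * s * r'), (s * s').
by transitivity ((x * r + y * s) * (x * r' + z * s')); [ring|rewrite e e' mulr1].
Qed.

Lemma comax1 x : comax x 1.
Proof. by exists 0, 1; rewrite mulr0 mulr1 add0r. Qed.

Lemma comax_exp x y n : comax x y -> comax x (y ^+ n).
Proof.
move=> xy; elim: n => [|n IH]; first by rewrite expr0; exact: comax1.
by rewrite exprS; exact: comax_mul.
Qed.

Lemma comax_gauss x y z : comax x y -> divides x (y * z) -> divides x z.
Proof.
move=> [r [s e]] [t et]; exists (r * z + s * t).
by rewrite -{1}[z]mul1r -e; ring: et.
Qed.

Lemma comax_cong x y z : divides x (y - z) -> comax x y -> comax x z.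
Proof.
move=> [t et] [r [s e]]; exists (r + t * s), s; rewrite -e.
by rewrite mulrDr mulrA -et; ring.
Qed.

Lemma comax_radl x y z : rad_divides x y -> comax y z -> comax x z.
Proof.
move=> [k xy] yz; apply: comax_divl xy _.
exact/comaxC/comax_exp/comaxC.
Qed.

Lemma rad_divides_mull x y z : rad_divides x y -> rad_divides x (y * z).
Proof.
by move=> [k xy]; exists k; rewrite exprMn; exact: divides_mulr.
Qed.

Lemma rad_divides_add x y z :
  rad_divides x y -> rad_divides x z -> rad_divides x (y + z).
Proof.
move=> [k xy] [l xz]; exists (k + l)%N; rewrite exprDn.
apply: (divides_sum (F := fun i => y ^+ (k + l - i) * z ^+ i *+ 'C(k + l, i))).
move=> i _; rewrite -mulr_natr; apply: divides_mulr.
have [li|il] := leqP l i.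
  by apply: divides_mull; apply: divides_trans xz _; exact: divides_pow_le.
apply: divides_mulr; apply: divides_trans xy _; apply: divides_pow_le.
by rewrite -addnBA ?leq_addr // ltnW.
Qed.

Lemma comax_self x : comax x x -> divides x 1.
Proof. by move=> [r [s e]]; exists (r + s); rewrite mulrDr. Qed.

Lemma divides1_comax x y : divides x 1 -> comax x y.
Proof. by move=> [r e]; exists r, 0; rewrite mulr0 addr0 -e. Qed.

Lemma divides1_divides x y : divides x 1 -> divides x y.
Proof. by move/(divides_mulr y); rewrite mul1r. Qed.

Lemma rad_divides1 x y : divides y 1 -> rad_divides x y -> divides x 1.
Proof.
move=> y1 [k xy]; apply: divides_trans xy _.
by rewrite -(expr1n _ k); exact: divides_exp.
Qed.

(** The idempotent b^i t, with a common exponent that can be taken as large as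
    needed. *)
Lemma pi_regular_idem b c i0 : pi_regular_quotients R -> c != 0 ->
  exists i t, (i0 <= i)%N /\ divides c (b ^+ i * (1 - b ^+ i * t)).
Proof.
move=> reg c0; have [i [t ct]] := reg b c c0.
exists (i0 + i)%N, (t ^+ (i0 + i)); split; first exact: leq_addr.
rewrite -exprMn [X in X * _]exprD -mulrA; apply: divides_mull.
have [S ->] := divides_1subX (b * t) (i0 + i).
by rewrite mulrA; exact: divides_mulr.
Qed.

End Divisibility.

(** * Neighbourhoods and closures in the Golomb space *)

Definition golomb_point (R : idomainType) (x : R) (x0 : x != 0) : golomb R :=
  exist _ x x0.

Definition coset (R : idomainType) (a b : R) : set (golomb R) :=
  [set z | divides b (\val z - a)].

Section GolombBasis.
Variable R : idomainType.
Implicit Types (a b c d e : R) (x y z : golomb R) (U V S : set (golomb R)).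

Lemma golomb_neq0 x : \val x != 0.
Proof. exact: (valP x). Qed.

Lemma golomb_inj x y : \val x = \val y -> x = y.
Proof. exact: val_inj. Qed.

Lemma coset_refl x b : coset (\val x) b x.
Proof. by rewrite /coset /= subrr; exists 0; rewrite mulr0. Qed.

Lemma coset_sub a b c : divides b c -> coset a c `<=` coset a b.
Proof. by move=> bc z; exact: divides_trans. Qed.

Lemma comax_coset b x y :
  comax b (\val x) -> coset (\val x) b y -> comax b (\val y).
Proof. by move=> bx yx; apply: comax_cong bx; exact: divides_subC. Qed.

Lemma open_coset a b : b != 0 -> comax b a -> open (coset a b).
Proof.
move=> b0 ab.
exists [set coset a b]; last by rewrite bigcup_set1.
move=> _ ->.
have : @golomb_subbase R (coset a b).
  exists a, [set r | divides b r]; split.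
  - split=> [|u v|u v]; first by exists 0; rewrite mulr0.
    + exact: divides_add.
    + exact: divides_mull.
  - apply/eqP => /seteqP [/(_ b) /= + _]; move/(_ (divides_refl b)) => bz.
    by rewrite bz eqxx in b0.
  - have [r [s e]] := ab.
    apply/seteqP; split=> // w _ J [[J0 JD JM] aJ].
    rewrite -(mulr1 w) -e; apply: (JM).
    apply: JD; rewrite mulrC; apply: (JM); apply: aJ; [right|left] => //.
    exact: divides_refl.
  - apply/seteqP; split=> z; rewrite /coset /golomb_coset /=.
      by move=> bz; exists (\val z - a) => //; rewrite addrC subrK.
    by move=> [i bi ->]; rewrite addrC addKr.
exact: (@finI_from1 (set (golomb R)) (golomb R) (@golomb_subbase R) id).
Qed.

Lemma golomb_open_subbase U x : open U -> U x ->
  exists s : seq (set (golomb R)),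
    [/\ forall A, A \in s -> @golomb_subbase R A, forall A, A \in s -> A x
      & forall z, (forall A, A \in s -> A z) -> U z].
Proof.
move=> oU.
have [B BfinI <-] : exists2 B : set (set (golomb R)),
    B `<=` @finI_from (set (golomb R)) (golomb R) (@golomb_subbase R) id &
    \bigcup_(V in B) V = U := oU.
move=> [V BV Vx]; have [D Dsub DV] := BfinI V BV.
exists (finmap.enum_fset D); split.
- by move=> A /Dsub; rewrite inE.
- by move=> A AD; have : V x := Vx; rewrite -DV; apply.
- by move=> z Dz; exists V => //; rewrite -DV => A AD; exact: Dz.
Qed.

(** Cosets of principal ideals suffice: if a + I is coprime, write 1 = i + a r
    with i in I and use iR, or any nonzero element of I when a is a unit. *)
Lemma golomb_basis U x : open U -> U x ->
  exists b, [/\ b != 0, comax b (\val x) & coset (\val x) b `<=` U].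
Proof.
move=> oU Ux; have [D [Ds Dx DU]] := golomb_open_subbase oU Ux.
suff: exists b, [/\ b != 0, comax b (\val x) &
    forall A, A \in D -> coset (\val x) b `<=` A].
  move=> [b [b0 bx bD]]; exists b; split => // z zb.
  by apply: DU => A AD; exact: bD zb.
elim: D Dx Ds {DU} => [|A D IH] Dx Ds.
  exists 1; split; [exact: oner_neq0|exact/comaxC/comax1|by []].
have [|B Bs|b [b0 bx bs]] := IH.
- by move=> B Bs; apply: Dx; rewrite in_cons Bs orbT.
- by apply: Ds; rewrite in_cons Bs orbT.
suff [c [c0 cx cA]] : exists c,
    [/\ c != 0, comax c (\val x) & coset (\val x) c `<=` A].
  exists (b * c); split; first by rewrite mulf_neq0.
    by apply/comaxC/comax_mul; exact/comaxC.
  move=> B; rewrite in_cons => /orP[/eqP -> |/bs bB].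
    apply: subset_trans cA; apply: coset_sub.
    by apply: divides_mull; exact: divides_refl.
  apply: subset_trans bB; apply: coset_sub.
  by apply: divides_mulr; exact: divides_refl.
have /= := Dx A (mem_head _ _).
have [a [I [[I0 ID IM] In0 Igen ->]]] := Ds A (mem_head _ _).
move=> [i0 Ii0 xi0].
have [i [Ii [r ei]]] : exists i, I i /\ exists r, i + \val x * r = 1.
  pose J := [set w | exists i, I i /\ exists r, i + \val x * r = w].
  have Jideal : is_ideal J.
    split.
    - by exists 0; split => //; exists 0; rewrite mulr0 addr0.
    - move=> _ _ [i [Ii [r <-]]] [j [Ij [s <-]]].
      by exists (i + j); split; [exact: ID|exists (r + s); ring].
    - move=> u _ [i [Ii [r <-]]]; exists (u * i); split; first exact: IM.
      by exists (u * r); ring.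
  have J1 : (ideal_gen (a |` I)) 1 by rewrite Igen.
  apply: (J1 J); split => // w [->|Iw].
    exists (- i0); split; first by rewrite -mulN1r; exact: IM.
    by exists 1; rewrite xi0; ring.
  by exists w; split => //; exists 0; rewrite mulr0 addr0.
have sub c : I c -> coset (\val x) c `<=` golomb_coset a I.
  move=> Ic z [t et]; exists (i0 + t * c); first by apply: ID => //; exact: IM.
  by rewrite addrA -xi0 mulrC -et addrC subrK.
have [i_0|i_n0] := eqVneq i 0; last first.
  by exists i; split => //; [exists 1, r; rewrite mulr1|exact: sub].
have [c [Ic c0]] : exists c, I c /\ c != 0.
  apply: contrapT => /forallNP noc; move/eqP: In0; apply.
  apply/seteqP; split => [c Ic|_ -> //]; have := noc c.
  by move/not_andP => -[//|/negP/negPn/eqP].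
exists c; split => //; last exact: sub.
by exists 0, r; rewrite mulr0; move: ei; rewrite i_0.
Qed.

Lemma closure_golombP S x :
  closure S x <->
  (forall e, e != 0 -> comax e (\val x) -> coset (\val x) e `&` S !=set0).
Proof.
split=> [Sx e e0 ex|Sx V].
  rewrite setIC; apply: Sx; apply: open_nbhs_nbhs; split; first exact: open_coset.
  exact: coset_refl.
rewrite nbhsE => -[W [oW Wx] WV].
have [e [e0 ex eW]] := golomb_basis oW Wx.
have [z [ze Sz]] := Sx e e0 ex.
by exists z; split => //; apply: WV; exact: eW.
Qed.

(** A coset x + eR meets a + bR exactly when x - a lies in bR + eR.  The value
    e = 0, which is allowed when x is a unit, gives no neighbourhood of x, but
    the conclusion persists and spares a case distinction to later proofs. *)
Lemma closure_coset a b x e : b != 0 -> closure (coset a b) x ->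
  comax e (\val x) -> exists r s, \val x - a = b * r + e * s.
Proof.
move=> b0 /closure_golombP cx ex.
have [e0|e_n0] := eqVneq e 0.
  have x1 : comax b (\val x).
    apply/comaxC/divides1_comax; have [r [s]] := ex.
    by rewrite e0 mul0r add0r => <-; exists s.
  have [z [[r er] [s es]]] := cx b b0 x1.
  exists (s - r), 0; rewrite mulr0 addr0 mulrBr -er -es; ring.
have [z [[r er] [s es]]] := cx e e_n0 ex.
exists s, (- r); rewrite mulrN -er -es; ring.
Qed.

Lemma coset_closure a b x : b != 0 ->
  (forall e, comax e (\val x) -> exists r s, \val x - a = b * r + e * s) ->
  closure (coset a b) x.
Proof.
move=> b0 cx; apply/closure_golombP => e e0 /cx [r [s ers]].
have ex : \val x = a + b * r + e * s by rewrite -addrA -ers addrC subrK.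
(* If the common element a + br happens to be zero, be is another one. *)
have [w0|w0] := eqVneq (a + b * r) 0; last first.
  exists (golomb_point w0); split; rewrite /coset /=.
    by exists (- s); rewrite ex; ring.
  by exists r; ring.
have be0 : b * e != 0 by rewrite mulf_neq0.
exists (golomb_point be0); rewrite /coset; split => /=.
  by exists (b - s); rewrite ex w0; ring.
by exists (e + r); rewrite -[b * e]addr0 -w0; ring.
Qed.

(** A point in all the primes containing b is subject to no congruence. *)
Lemma rad_closure a b x : b != 0 -> rad_divides b (\val x) -> closure (coset a b) x.
Proof.
move=> b0 bx; apply: coset_closure => // e /comaxC xe.
have [r [s ers]] := comax_radl bx xe.
exists (r * (\val x - a)), (s * (\val x - a)).
by rewrite !mulrA -mulrDl ers mul1r.
Qed.

End GolombBasis.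

(** * Intersections of closed neighbourhoods of two points *)

Definition closure_filter (X : topologicalType) (x y : X) : set (set X) :=
  [set S | exists U V,
    [/\ open U, open V, U x, V y & closure U `&` closure V `<=` S]].

Definition radical (R : idomainType) (d : R) : set (golomb R) :=
  [set z | rad_divides d (\val z)].

Lemma closure_filterC (X : topologicalType) (x y : X) S :
  closure_filter x y S -> closure_filter y x S.
Proof.
by move=> [U [V [oU oV Ux Vy UVS]]]; exists V, U; split => //; rewrite setIC.
Qed.

Section ClosureFilter.
Variable R : idomainType.
Hypothesis reg : pi_regular_quotients R.
Implicit Types (a b c d e : R) (x y z u : golomb R) (U V S : set (golomb R)).

Lemma closure_filter_golomb x y S : closure_filter x y S ->
  exists b c, [/\ b != 0, c != 0, comax b (\val x), comax c (\val y) &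
    closure (coset (\val x) b) `&` closure (coset (\val y) c) `<=` S].
Proof.
move=> [U [V [oU oV Ux Vy UVS]]].
have [b [b0 bx bU]] := golomb_basis oU Ux.
have [c [c0 cy cV]] := golomb_basis oV Vy.
exists b, c; split => // z [zb zc]; apply: UVS.
by split; [exact: closureS bU _ zb|exact: closureS cV _ zc].
Qed.

(** With delta = x - y dividing d^i (1 - d t), the modulus d^(i+1) is fine
    enough: a point z in both closures satisfies d^(i+1) | z^j delta for some j,
    and delta can then be cancelled against d^i, leaving d | z^j. *)
Lemma radical_closure_filter d x y : d != 0 -> x <> y ->
  comax d (\val x) -> comax d (\val y) -> closure_filter x y (radical d).
Proof.
move=> d0 xy dx dy.
have xy0 : \val x - \val y != 0.
  by rewrite subr_eq0; apply/eqP => /golomb_inj.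
have [i [t [w ew]]] := reg d xy0.
have dm0 : d ^+ i.+1 != 0 by rewrite expf_neq0.
have dmx a : comax d a -> comax (d ^+ i.+1) a.
  by move=> /comaxC da; exact/comaxC/comax_exp.
exists (coset (\val x) (d ^+ i.+1)), (coset (\val y) (d ^+ i.+1)).
split; [exact/open_coset/dmx|exact/open_coset/dmx|exact: coset_refl|
  exact: coset_refl|].
move=> z [zx zy]; have [j [s [v ev]]] := reg (\val z) dm0.
have ez : comax (1 - \val z * s) (\val z) by exists 1, s; ring.
have [r [r' er]] := closure_coset dm0 zx ez.
have [q [q' eq]] := closure_coset dm0 zy ez.
exists j.
pose p := \val z ^+ j * (q - r) + v * (q' - r').
have ep : \val z ^+ j * (\val x - \val y) = d ^+ i.+1 * p.
  have -> : \val x - \val y = (\val z - \val y) - (\val z - \val x) by ring.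
  rewrite er eq /p [RHS]mulrDr [_ * (v * _)]mulrA -ev; ring.
exists (w * p + \val z ^+ j * t).
apply: (mulIf xy0); rewrite ep exprS.
have : d ^+ i * p = (\val x - \val y) * (w * p + \val z ^+ j * t).
  transitivity (d ^+ i * (1 - d * t) * p + d ^+ i.+1 * p * t).
    by rewrite exprS; ring.
  by rewrite ew -ep; ring.
by move=> e; rewrite -mulrA e; ring.
Qed.

(** Two test points in the closures of x + bR and y + cR are used: bc, and f y
    with f the idempotent modulo c that vanishes at the primes containing b.
    If d divides powers of both, a prime containing d and x contains bc and f y
    but not b; so it contains c, hence not y, hence f, but also 1 - f because
    b^i (1 - f) is in cR.  The computation below is this argument with explicit
    Bezout coefficients: it produces a combination of bc and f y that is coprime
    to x. *)
Lemma closure_filter_radical d x y :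
  closure_filter x y (radical d) -> comax d (\val x).
Proof.
move=> /closure_filter_golomb [b [c [b0 c0 bx cy bcd]]].
have [i [t [i1 [s es]]]] := pi_regular_idem b 1 reg c0.
have bf : divides b (b ^+ i * t).
  by apply: divides_mulr; rewrite -(prednK i1) exprS; exists (b ^+ i.-1).
have [f fE] : exists f, f = b ^+ i * t by exists (b ^+ i * t).
rewrite -fE in es bf.
have bc0 : b * c != 0 by rewrite mulf_neq0.
have d_bc : rad_divides d (b * c).
  apply: (bcd (golomb_point bc0)); split; apply: rad_closure => //; exists 1%N;
    rewrite expr1; [apply: divides_mulr|apply: divides_mull]; exact: divides_refl.
have d_fy : rad_divides d (f * \val y).
  have [->|f0] := eqVneq f 0.
    by exists 1%N; rewrite mul0r; exists 0; rewrite mulr0.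
  have fy0 : f * \val y != 0 by rewrite mulf_neq0 ?golomb_neq0.
  apply: (bcd (golomb_point fy0)); split => /=.
    by apply: rad_closure => //; exists 1%N; rewrite expr1; exact: divides_mulr.
  apply: coset_closure => //= e [p [q epq]].
  exists (- (s * t * \val y * \val y * q)), (- p * (1 - f) * \val y).
  have fs : f * (1 - f) = c * (s * t) by rewrite mulrA -es {1}fE; ring.
  have -> : f * \val y - \val y = - ((1 - f) * \val y * (e * p + f * \val y * q)).
    by rewrite epq; ring.
  transitivity (- (e * p * (1 - f) * \val y) - f * (1 - f) * (\val y * \val y * q)).
    by ring.
  by rewrite fs; ring.
have xB : comax (\val x) (b ^+ i) by apply: comax_exp; exact: comaxC.
have [p [q epq]] := xB.
have [p' [q' epq']] := cy.
have [q'' [p'' epq'']] := bx.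
pose C := f * p' + q * s.
apply: comaxC.
have rd : rad_divides d (b * c * (q'' * C) + f * \val y * q').
  by apply: rad_divides_add; exact: rad_divides_mull.
apply: comaxC (comax_radl rd _); apply: comaxC.
exists (p * (1 - f) + c * C * p''), 1; rewrite mulr1.
have e1 : 1 - f = \val x * p * (1 - f) + q * (c * s).
  by rewrite -es -[LHS]mul1r -epq; ring.
have e2 : f = c * p' * f + \val y * q' * f by rewrite -mulrDl epq' mul1r.
have e3 : c * C = b * q'' * c * C + \val x * p'' * c * C.
  by rewrite -2!mulrDl epq'' mul1r.
transitivity (\val x * p * (1 - f)
  + (b * q'' * c * C + \val x * p'' * c * C) + \val y * q' * f).
  by ring.
rewrite -e3 /C; transitivity ((\val x * p * (1 - f) + q * (c * s))
  + (c * p' * f + \val y * q' * f)); first by ring.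
by rewrite -e1 -e2; ring.
Qed.

(** At a prime that does not contain x, a small set of F(u,x) is contained in
    that prime; at a prime containing x the condition is weaker.  So F(u,x)
    grows when primes are removed from x. *)
Lemma rad_divides_closure_filterP u x y : divides (\val u) 1 -> x <> u -> y <> u ->
  closure_filter u y `<=` closure_filter u x <-> rad_divides (\val x) (\val y).
Proof.
move=> u1 xu yu; split => [yx|xy S].
  have [i [t yt]] := reg (\val y) (golomb_neq0 x).
  have ey : comax (1 - \val y * t) (\val y) by exists 1, t; ring.
  have cop e : e != 0 -> comax e (\val y) -> comax e (\val x).
    move=> e0 e_y; apply: (closure_filter_radical (y := u)); apply: closure_filterC.
    apply: yx; apply: radical_closure_filter => //; last exact/comaxC/divides1_comax.
    by move=> uy; apply: yu.
  have [e0|e0] := eqVneq (1 - \val y * t) 0; last first.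
    by exists i; apply: comax_gauss (comaxC (cop _ e0 ey)) _; rewrite mulrC.
  exists 0%N; rewrite expr0; apply: comax_self; apply: cop; first exact: golomb_neq0.
  by apply/comaxC/divides1_comax; exists t; apply/eqP; rewrite -subr_eq0 e0.
move=> /closure_filter_golomb [b [c [b0 c0 bu cy bcS]]].
have cx : comax c (\val x) by apply: comaxC; apply: comax_radl xy _; exact: comaxC.
have [U [V [oU oV Uu Vx UV]]] : closure_filter u x (radical c).
  apply: radical_closure_filter => //; last exact/comaxC/divides1_comax.
  by move=> ux; apply: xu.
exists (coset (\val u) b `&` U), V; split => //.
- by apply: openI => //; exact: open_coset.
- by split => //; exact: coset_refl.
move=> z [zU zV]; apply: bcS; split.
  by apply: closureS zU => ? [].
apply: rad_closure => //; apply: UV; split => //.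
by apply: closureS zU => ? [].
Qed.

End ClosureFilter.

(** * Invariance under homeomorphisms *)

Definition maximal_closure_filter (X : topologicalType) (x : X) :=
  exists y, x <> y /\ forall x' y', x' <> y' ->
    closure_filter x' y' `<=` closure_filter x y.

Section HomeoInvariance.
Variables (X Y : topologicalType) (f : X -> Y) (g : Y -> X).
Hypotheses (cf : continuous f) (cg : continuous g).
Hypotheses (fK : cancel f g) (gK : cancel g f).

Lemma closure_preimage (A : set X) y : closure (g @^-1` A) y -> closure A (g y).
Proof.
move=> Ay B /cg nB; have [z [Az Bz]] := Ay _ nB.
by exists (g z).
Qed.

Lemma closure_filter_homeo x y S :
  closure_filter x y S -> closure_filter (f x) (f y) (g @^-1` S).
Proof.
move=> [U [V [oU oV Ux Vy UVS]]].
exists (g @^-1` U), (g @^-1` V); split; rewrite /= ?fK //.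
- by move/continuousP: cg; apply.
- by move/continuousP: cg; apply.
by move=> z [/closure_preimage zU /closure_preimage zV]; apply: UVS.
Qed.

End HomeoInvariance.

Lemma closure_filter_sub_homeo (X Y : topologicalType) (f : X -> Y) (g : Y -> X)
    x y x' y' :
  continuous f -> continuous g -> cancel f g -> cancel g f ->
  closure_filter x y `<=` closure_filter x' y' ->
  closure_filter (f x) (f y) `<=` closure_filter (f x') (f y').
Proof.
move=> cf cg fK gK sub S /(closure_filter_homeo cf gK).
rewrite !fK => /sub /(closure_filter_homeo cg fK).
move=> [U [V [oU oV Ux Vy UVS]]];
by exists U, V; split => // z /UVS /=; rewrite gK.
Qed.

Lemma maximal_closure_filter_homeo (X Y : topologicalType)
    (f : X -> Y) (g : Y -> X) x :
  continuous f -> continuous g -> cancel f g -> cancel g f ->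
  maximal_closure_filter x -> maximal_closure_filter (f x).
Proof.
move=> cf cg fK gK [y [xy xmax]]; exists (f y); split.
  by move=> /(congr1 g); rewrite !fK.
move=> x' y' xy'; rewrite -(gK x') -(gK y').
apply: closure_filter_sub_homeo => //; apply: xmax.
by move=> /(congr1 f); rewrite !gK.
Qed.

Section Units.
Variable R : idomainType.
Hypothesis reg : pi_regular_quotients R.
Hypothesis two_neq0 : (2%:R : R) != 0.
Implicit Types x y : golomb R.

Lemma opp_golomb_proof x : - \val x != 0.
Proof. by rewrite oppr_eq0 golomb_neq0. Qed.

(** Each F(x',y') is contained in the filter generated by all radicals, which
    is F(x,-x) when x is a unit. *)
Lemma maximal_closure_filterP x : maximal_closure_filter x <-> divides (\val x) 1.
Proof.
have oppx z : z <> golomb_point (opp_golomb_proof z).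
  move=> /(congr1 val) /= /eqP; rewrite -subr_eq0 opprK -mulr2n -mulr_natr.
  by rewrite mulf_eq0 (negbTE (golomb_neq0 z)) (negbTE two_neq0).
split=> [[y [xy xmax]]|x1].
  pose one := golomb_point (oner_neq0 R).
  apply: comax_self; apply: (closure_filter_radical reg (y := y)).
  apply: (xmax _ _ (oppx one)); apply: radical_closure_filter => //=.
  - exact: golomb_neq0.
  - exact: comax1.
  - by exists 0, (-1); rewrite /= mulr0 add0r mulrNN mulr1.
exists (golomb_point (opp_golomb_proof x)); split => // x' y' xy' S.
move=> /closure_filter_golomb [b [c [b0 c0 bx cy bcS]]].
have : closure_filter x (golomb_point (opp_golomb_proof x)) (radical (b * c)).
  apply: radical_closure_filter => //=; first by rewrite mulf_neq0.
    exact/comaxC/divides1_comax.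
  apply/comaxC/divides1_comax; have [r e] := x1; by exists (- r); rewrite mulrNN.
move=> [U [V [oU oV Ux Vx UV]]]; exists U, V; split => // z /UV [k bcz].
apply: bcS; split; apply: rad_closure => //; exists k; apply: divides_trans bcz;
  [apply: divides_mulr|apply: divides_mull]; exact: divides_refl.
Qed.

End Units.

Section Transport.
Variables (R S : idomainType).
Variables (f : golomb R -> golomb S) (g : golomb S -> golomb R).
Hypotheses (regR : pi_regular_quotients R) (regS : pi_regular_quotients S).
Hypotheses (twoR : (2%:R : R) != 0) (twoS : (2%:R : S) != 0).
Hypotheses (cf : continuous f) (cg : continuous g).
Hypotheses (fK : cancel f g) (gK : cancel g f).

Lemma homeo_unit (x : golomb R) : divides (\val x) 1 -> divides (\val (f x)) 1.
Proof.
move=> /(maximal_closure_filterP regR twoR) x1.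
apply/(maximal_closure_filterP regS twoS).
exact: (maximal_closure_filter_homeo cf cg).
Qed.

Lemma homeo_rad_divides (x y : golomb R) :
  rad_divides (\val x) (\val y) -> rad_divides (\val (f x)) (\val (f y)).
Proof.
pose u := golomb_point (oner_neq0 R).
have u1 : divides (\val u) 1 by exact: divides_refl.
have fu1 := homeo_unit u1.
have [-> _|/eqP xu] := eqVneq x u.
  by exists 0%N; exact: divides1_divides.
have [-> xu1|/eqP yu] := eqVneq y u.
  have x1 : divides (\val (f x)) 1 by apply: homeo_unit; exact: rad_divides1 xu1.
  by exists 0%N; exact: divides1_divides.
have fneq z : z <> u -> f z <> f u by move=> zu /(can_inj fK).
move=> /(rad_divides_closure_filterP regR u1 xu yu) sub.
apply/(rad_divides_closure_filterP regS fu1 (fneq _ xu) (fneq _ yu)).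
exact: closure_filter_sub_homeo sub.
Qed.

End Transport.

Section Transport2.
Variables (R S : idomainType).
Variables (f : golomb R -> golomb S) (g : golomb S -> golomb R).
Hypotheses (regR : pi_regular_quotients R) (regS : pi_regular_quotients S).
Hypotheses (twoR : (2%:R : R) != 0) (twoS : (2%:R : S) != 0).
Hypotheses (cf : continuous f) (cg : continuous g).
Hypotheses (fK : cancel f g) (gK : cancel g f).

(** With u = 1, coprimality of x and y says that the radical of x, a set
    defined by radical divisibility, belongs to F(y,u). *)
Lemma homeo_comax (x y : golomb R) :
  comax (\val x) (\val y) -> comax (\val (f x)) (\val (f y)).
Proof.
move=> xy; pose u := golomb_point (oner_neq0 R).
have fu1 : divides (\val (f u)) 1.
  by apply: (homeo_unit regR regS twoR twoS cf cg fK gK); exact: divides_refl.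
have [<-|/eqP uy] := eqVneq u y; first exact/comaxC/divides1_comax.
have : closure_filter y u (radical (\val x)).
  apply: radical_closure_filter => //; [exact: golomb_neq0| |exact: comax1].
  by move=> yu; apply: uy.
move=> /(closure_filter_homeo cg fK) [U [V [oU oV Ux Vu UV]]].
apply: (closure_filter_radical regS (y := f u)); exists U, V; split => // z /UV /=.
by move=> /(homeo_rad_divides regR regS twoR twoS cf cg fK gK); rewrite gK.
Qed.

End Transport2.

(** * Recovering the adic topologies *)

Section ClopenAdic.
Variable R : idomainType.
Hypothesis reg : pi_regular_quotients R.

Definition coprime_to (d : R) : set (golomb R) := [set z | comax d (\val z)].

(** Modulo b, the ideals generated by the powers of d are stationary from
    d^i on. *)
Lemma divides_stable (b d t y : R) i j : (0 < i)%N ->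
  divides b (d ^+ i * (1 - d ^+ i * t)) -> divides b (d ^+ j * y) ->
  divides b (d ^+ i * y).
Proof.
move=> i0 bt by_.
have -> : d ^+ i * y = d ^+ i * (1 - (d ^+ i * t) ^+ j) * y
    + d ^+ i * (d ^+ i * t) ^+ j * y.
  by ring.
apply: divides_add.
  apply: divides_mulr; have [T ->] := divides_1subX (d ^+ i * t) j.
  by rewrite mulrA; exact: divides_mulr.
rewrite exprMn -exprM -(prednK i0) mulSn exprD.
set p := d ^+ (_ * _).
have -> : d ^+ i.-1.+1 * (d ^+ j * p * t ^+ j) * y =
  d ^+ j * y * (d ^+ i.-1.+1 * p * t ^+ j) by ring.
exact: divides_mulr.
Qed.

(** Let a + bR lie in S and let d^i generate the stationary power of dR modulo
    b.  Suppose that z = a modulo d^i is outside S, with z + eR disjoint from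
    S.  The point w = (1 - F) z, where F is the idempotent modulo be vanishing
    at the primes containing d, agrees with z at these primes and lies in all
    other primes containing be.  It is therefore in the closures of both cosets,
    although it is coprime to d and must have a neighbourhood avoiding one of
    them. *)
Lemma clopen_coprime_adic (d : R) (S : set (golomb R)) a :
  d != 0 -> ~ divides d 1 -> S `<=` coprime_to d -> open S ->
  open (coprime_to d `\` S) -> S a -> exists k, coset (\val a) (d ^+ k) `<=` S.
Proof.
move=> d0 dn1 Sd oS oT Sa.
have [b [b0 ba bS]] := golomb_basis oS Sa.
have [i [t [i0 bt]]] := pi_regular_idem d 1 reg b0.
exists i => z [r0 za]; apply: contrapT => nSz.
have ddi : divides d (d ^+ i).
  by rewrite -(prednK i0) exprS; apply: divides_mulr; exact: divides_refl.
have dz : comax d (\val z).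
  apply: (comax_coset (Sd a Sa)); rewrite /coset /= za; exact: divides_mulr.
have [e [e0 ez eT]] := golomb_basis oT (conj dz nSz).
have be0 : b * e != 0 by rewrite mulf_neq0.
have [j [s [ij [n en]]]] := pi_regular_idem d i reg be0.
have [F FE] : exists F, F = d ^+ j * s by exists (d ^+ j * s).
rewrite -FE in en.
have dF : divides d F.
  by rewrite FE -(prednK (leq_trans i0 ij)) exprS -mulrA; exists (d ^+ j.-1 * s).
have F1 : (1 - F) * \val z != 0.
  rewrite mulf_neq0 ?golomb_neq0 // subr_eq0; apply/eqP => F1.
  by apply: dn1; rewrite F1.
have FF : F * (1 - F) = b * e * (s * n) by rewrite {1}FE mulrAC en; ring.
have bF : divides b (d ^+ i * (1 - F)).
  by apply: (divides_stable i0 bt (j := j)); rewrite en -mulrA; exists (e * n).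
have Fz r p q : r * p + (1 - F) * \val z * q = 1 ->
    - (F * \val z) = b * e * (- (s * n * \val z * \val z * q))
      + r * (- (F * \val z * p)).
  move=> rpq; transitivity (- (F * \val z) * (r * p + (1 - F) * \val z * q)).
    by rewrite rpq mulr1.
  transitivity (- (F * \val z * r * p)
    - F * (1 - F) * (\val z * \val z * q)); first by ring.
  by rewrite FF; ring.
pose w := golomb_point F1.
have dw : comax d (\val w).
  apply: comax_cong dz; rewrite /=.
  have -> : \val z - (1 - F) * \val z = F * \val z by ring.
  exact: divides_mulr.
have wz : closure (coset (\val z) e) w.
  apply: coset_closure => //= r [p [q rpq]].
  have -> : (1 - F) * \val z - \val z = - (F * \val z) by ring.
  rewrite (Fz _ _ _ rpq); 
  exists (- (b * (s * n * \val z * \val z * q))), (- (F * \val z * p)).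
  by ring.
have wa : closure (coset (\val a) b) w.
  apply: coset_closure => //= r [p [q rpq]].
  have -> : (1 - F) * \val z - \val a =
      (\val z - \val a) * (r * p + (1 - F) * \val z * q) - (F * \val z).
    by rewrite rpq; ring.
  have [m em] := bF.
  rewrite (Fz _ _ _ rpq) za.
  have -> : d ^+ i * r0 * (r * p + (1 - F) * \val z * q) =
      d ^+ i * r0 * r * p + d ^+ i * (1 - F) * (\val z * q * r0).
    by ring.
  rewrite em.
  exists (m * (\val z * q * r0) - e * (s * n * \val z * \val z * q)),
    (d ^+ i * r0 * p - F * \val z * p).
  by ring.
have [Sw|nSw] := pselect (S w).
  have [y [/eT [_ nSy] Sy]] := wz S (open_nbhs_nbhs (conj oS Sw)).
  exact: nSy.
have Tw : (coprime_to d `\` S) w by [].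
have [y [/bS Sy [_ nSy]]] := wa _ (open_nbhs_nbhs (conj oT Tw)).
exact: nSy.
Qed.

Lemma open_coprime_adic (d : R) k a : d != 0 -> comax d a ->
  open (coset a (d ^+ k.+1)).
Proof.
move=> d0 da; apply: open_coset; first by rewrite expf_neq0.
exact/comaxC/comax_exp/comaxC.
Qed.

Lemma open_coprime_coset_compl (d : R) k a : d != 0 ->
  open (coprime_to d `\` coset a (d ^+ k.+1)).
Proof.
move=> d0.
have -> : coprime_to d `\` coset a (d ^+ k.+1) =
    \bigcup_(b in coprime_to d `\` coset a (d ^+ k.+1)) coset (\val b) (d ^+ k.+1).
  apply/seteqP; split=> [z zd|z [b [db nab] zb]].
    by exists z => //; exact: coset_refl.
  split; last first.
    by move=> za; apply: nab; apply: divides_sub_trans za; exact: divides_subC.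
  apply: (comax_coset db); apply: divides_trans zb; rewrite exprS.
  by apply: divides_mulr; exact: divides_refl.
by apply: bigcup_open => b [db _]; exact: open_coprime_adic.
Qed.

End ClopenAdic.

(** * Noetherian rings, dimension one and complete integral closure *)

Section Noetherian.
Variable R : comNzRingType.
Hypothesis noeth : noetherian R.
Implicit Types (I J P : set R).

Lemma noetherian_chain (J : nat -> set R) :
  (forall n, is_ideal (J n)) -> (forall n, J n `<=` J n.+1) ->
  exists M, forall m, J m `<=` J M.
Proof.
move=> Jid Jinc.
have Jle m n : (m <= n)%N -> J m `<=` J n.
  move=> /subnK <-; elim: (n - m)%N => [//|k IH].
  by apply: subset_trans IH _; rewrite addSn.
pose U := \bigcup_n J n.
have Uid : is_ideal U.
  split; first by exists 0%N => //; case: (Jid 0%N).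
    move=> x y [m _ Jx] [n _ Jy]; exists (maxn m n) => //.
    have [_ + _] := Jid (maxn m n); apply.
      by apply: Jle Jx; rewrite leq_maxl.
    by apply: Jle Jy; rewrite leq_maxr.
  by move=> a x [m _ Jx]; exists m => //; have [_ _] := Jid m; apply.
have [s Us] := noeth Uid.
have [M sM] : exists M, [set` s] `<=` J M.
  have : [set` s] `<=` U by rewrite Us => x sx I [_]; exact.
  elim: s {Us} => [|x s IH] sU; first by exists 0%N.
  have [M sM] : exists M, [set` s] `<=` J M.
    by apply: IH => y sy; apply: sU; rewrite /= in_cons (sy : y \in s) orbT.
  have [n _ Jx] : U x by apply: sU; rewrite /= in_cons eqxx.
  exists (maxn n M) => y /=; rewrite in_cons => /orP[/eqP ->|/sM].
    by apply: Jle Jx; rewrite leq_maxl.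
  by apply: Jle; rewrite leq_maxr.
exists M => m x Jx; have : U x by exists m.
by rewrite Us; apply; split.
Qed.

Lemma noetherian_maximal (F : set (set R)) I0 :
  F `<=` @is_ideal R -> F I0 ->
  exists I, F I /\ forall J, F J -> I `<=` J -> J `<=` I.
Proof.
move=> Fid FI0; apply: contrapT => /forallNP nomax.
have /choice [nx nxP] : forall I, exists J, F I -> [/\ F J, I `<=` J & ~ J `<=` I].
  move=> I; have [FI|nFI] := pselect (F I); last by exists I.
  have := nomax I; move=> /not_andP[//|/existsNP [J]].
  by move=> /not_implyP [FJ /not_implyP [IJ JI]]; exists J.
pose J n := iter n nx I0.
have FJ n : F (J n) by elim: n => //= n /nxP [].
have Jinc n : J n `<=` J n.+1 by have [] := nxP _ (FJ n).
have [M JM] := noetherian_chain (fun n => Fid _ (FJ n)) Jinc.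
by have [_ _] := nxP _ (FJ M); apply; exact: (JM M.+1).
Qed.

Lemma prime_avoiding I (S : set R) : is_ideal I -> S 1 ->
  (forall x y, S x -> S y -> S (x * y)) -> I `&` S = set0 ->
  exists P, [/\ is_prime_ideal P, I `<=` P & P `&` S = set0].
Proof.
move=> Iid S1 SM IS.
pose F : set (set R) := [set J | [/\ is_ideal J, I `<=` J & J `&` S = set0]].
have [P [[Pid IP PS] Pmax]] :
    exists P, F P /\ forall J, F J -> P `<=` J -> J `<=` P.
  by apply: (@noetherian_maximal _ I); [by move=> J []|by split].
have [P0 PD PM] := Pid.
exists P; split=> //; split=> //.
  apply/eqP => PT; have : (P `&` S) 1 by rewrite PT.
  by rewrite PS.
have meet x : ~ P x -> exists p r, P p /\ S (p + x * r).
  move=> nPx; apply: contrapT => nex; apply: nPx.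
  apply: (Pmax [set w | exists p r, P p /\ w = p + x * r]).
  - split.
    + split.
      * by exists 0, 0; rewrite mulr0 addr0.
      * move=> _ _ [p [r [Pp ->]]] [q [s [Pq ->]]].
        by exists (p + q), (r + s); split; [exact: PD|ring].
      * move=> a _ [p [r [Pp ->]]]; exists (a * p), (a * r).
        by split; [exact: PM|ring].
    + by move=> w /IP Pw; exists w, 0; rewrite mulr0 addr0.
    + apply/seteqP; split=> // w [[p [r [Pp ew]]] Sw]; apply: nex.
      by exists p, r; rewrite -ew.
  - by move=> w Pw; exists w, 0; rewrite mulr0 addr0.
  - by exists 0, 1; rewrite mulr1 add0r.
move=> x y Pxy; apply: contrapT.
move=> /not_orP [/meet [p [r [Pp Sp]]] /meet [q [s [Pq Sq]]]].
have : (P `&` S) ((p + x * r) * (q + y * s)).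
  split; last exact: SM.
  have -> : (p + x * r) * (q + y * s) =
    (q + y * s) * p + (x * r * q + r * s * (x * y)) by ring.
  by apply: (PD); [exact: PM|apply: PD; exact: PM].
by rewrite PS.
Qed.

End Noetherian.

(** If no b^i (1 - b t) were in cR, a prime P containing c would avoid all of
    them.  Then b is not in P and is not invertible modulo P, and a prime
    containing P and b gives a chain of length two above 0. *)
Lemma dimension1_pi_regular (R : idomainType) :
  noetherian R -> has_krull_dim R 1 -> pi_regular_quotients R.
Proof.
move=> noeth [_ dim1] b c c0.
pose S : set R := [set x | exists i t, x = b ^+ i * (1 - b * t)].
apply: contrapT => nex.
have cid (a : R) : is_ideal [set x | divides a x].
  split; first by exists 0; rewrite mulr0.
    by move=> x y; exact: divides_add.
  by move=> a' x; exact: divides_mull.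
have [P [Pprime cP PS]] : exists P, [/\ is_prime_ideal P,
    [set x | divides c x] `<=` P & P `&` S = set0].
  apply: prime_avoiding => //.
  - by exists 0%N, 0; ring.
  - move=> _ _ [i [t ->]] [j [s ->]]; exists (i + j)%N, (t + s - b * t * s).
    by rewrite exprD; ring.
  - apply/seteqP; split=> // x [/= cx [i [t ex]]]; apply: nex.
    by exists i, t; rewrite -ex.
have nP x : P x -> ~ S x.
  by move=> Px Sx; have : (P `&` S) x by []; rewrite PS.
have [[P0 PD PM] _ _] := Pprime.
have nPb : ~ P b by move=> /nP; apply; exists 1%N, 0; ring.
have [Q [Qprime PQ _]] : exists Q, [/\ is_prime_ideal Q,
    [set w | exists p r, P p /\ w = p + b * r] `<=` Q & Q `&` [set 1] = set0].
  apply: prime_avoiding => //.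
  - split.
    + by exists 0, 0; rewrite mulr0 addr0.
    + move=> _ _ [p [r [Pp ->]]] [q [s [Pq ->]]].
      by exists (p + q), (r + s); split; [exact: PD|ring].
    + move=> a _ [p [r [Pp ->]]]; exists (a * p), (a * r).
      by split; [exact: PM|ring].
  - by move=> x y /= -> ->; rewrite mulr1.
  - apply/seteqP; split=> // w [[p [r [Pp ew]]] /= e1].
    apply: (nP _ Pp); exists 0%N, r; rewrite expr0 mul1r -e1 ew; ring.
pose C n : set R := match n with 0%N => [set 0] | 1%N => P | _ => Q end.
suff /dim1 : prime_chain 2 C by [].
split.
  move=> [|[|n]] //= _; split.
  - split=> [//|x y -> ->|a x ->]; rewrite /= ?addr0 ?mulr0 //.
  - apply/eqP => e; have : [set (0 : R)] 1 by rewrite e.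
    by move/eqP; rewrite oner_eq0.
  - by move=> x y /eqP; rewrite mulf_eq0 => /orP[] /eqP ->; [left|right].
move=> [|[|n]] //= _; split.
- by move=> _ ->.
- move=> sub; have : P c by apply: cP; exact: divides_refl.
  by move=> /sub /eqP; apply/negP.
- by move=> w Pw; apply: PQ; exists w, 0; rewrite mulr0 addr0.
- move=> sub; apply: nPb; apply: sub; apply: PQ.
  by exists 0, 1; rewrite mulr1 add0r.
Qed.

(** All powers of theta = w / x have the common denominator y, so R[theta] y is
    an ideal of R; being finitely generated, it yields a monic equation
    for theta. *)
Lemma completely_integrally_closed (R : idomainType) (x y w : R) :
  noetherian R -> integrally_closed R -> x != 0 -> y != 0 ->
  (forall m, divides (x ^+ m) (w ^+ m * y)) -> divides x w.
Proof.
move=> noeth ic x0 y0 xw.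
have /choice [a aP] := xw.
pose J m : set R := [set v | exists r : nat -> R, v = \sum_(i < m) r i * a i].
have Jid m : is_ideal (J m).
  split.
  - by exists (fun=> 0); rewrite big1 // => i _; rewrite mul0r.
  - move=> _ _ [r ->] [s ->]; exists (fun i => r i + s i).
    by rewrite -big_split; apply: eq_bigr => i _; rewrite mulrDl.
  - move=> b _ [r ->]; exists (fun i => b * r i).
    by rewrite mulr_sumr; apply: eq_bigr => i _; rewrite mulrA.
have Jinc m : J m `<=` J m.+1.
  move=> _ [r ->]; exists (fun i => if (i < m)%N then r i else 0).
  rewrite big_ord_recr /= ltnn mul0r addr0.
  by apply: eq_bigr => i _; rewrite ltn_ord.
have [M JM] := noetherian_chain noeth Jid Jinc.
have [r er] : J M (a M).
  apply: (JM M.+1); exists (fun i => (i == M)%:R).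
  rewrite big_ord_recr /= eqxx mul1r big1 ?add0r // => i _.
  by rewrite ltn_eqF ?ltn_ord // mul0r.
have fx0 : tofrac x != 0 by rewrite tofrac_eq0.
have fy0 : tofrac y != 0 by rewrite tofrac_eq0.
pose th := tofrac w / tofrac x.
have tha m : tofrac (a m) = th ^+ m * tofrac y.
  rewrite expr_div_n mulrAC; apply: (canRL (mulfK _)); first by rewrite expf_neq0.
  by rewrite -!tofracXn -!tofracM aP mulrC.
have [u eu] : exists u : R, th = tofrac u.
  apply: ic; exists ('X^M - \poly_(i < M) r i).
    apply/monicP; rewrite lead_coefDl ?lead_coefXn // size_polyN size_polyXn ltnS.
    exact: size_poly.
  apply/rootP; rewrite rmorphB /= map_polyXn hornerD hornerN hornerXn.
  apply/eqP; rewrite subr_eq0; apply/eqP; apply: (mulIf fy0).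
  have -> : map_poly (@tofrac R) (\poly_(i < M) r i) = \poly_(i < M) tofrac (r i).
    by apply/polyP => i; rewrite coef_map !coef_poly; case: ifP; rewrite ?rmorph0.
  rewrite -tha er raddf_sum /=.
  rewrite horner_poly mulr_suml; apply: eq_bigr => i _.
  by rewrite tofracM tha mulrA.
exists u; apply/eqP; rewrite -tofrac_eq tofracM -eu /th mulrC divfK //.
Qed.

(** * Divisors of the powers of a radical atom *)

Lemma exists_least (Q : nat -> Prop) n : Q n ->
  exists m, Q m /\ forall k, Q k -> (m <= k)%N.
Proof.
move=> Qn; have ex : exists n, `[< Q n >] by exists n; apply/asboolP.
case: (ex_minnP ex) => m /asboolP Qm mle; exists m; split=> // k /asboolP; exact: mle.
Qed.

(** A maximal proper colon ideal P = (xR : w) is prime and, by the dichotomy,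
    contains all the elements that are not coprime to x.  The order at P of y
    is the largest m such that theta^m y is in R, where theta = w / x; it is
    finite by complete integral closure.  Among the divisors of powers of x,
    divisibility is comparison of orders, because theta^m y is outside P when m
    is the order of y and thus coprime to y.  A nonunit of least order then
    generates them all. *)
Lemma radical_atom_powers (R : idomainType) (x : R) :
  noetherian R -> integrally_closed R ->
  (forall u : R, divides u 1 -> exists s : nat, u = (-1) ^+ s) ->
  x != 0 -> ~ divides x 1 ->
  (forall z, z != 0 -> comax x z \/ rad_divides x z) ->
  exists p, forall w, rad_divides w x ->
    exists s j, w = (-1) ^+ s * p ^+ j.
Proof.
move=> noeth ic units x0 xn1 dich.
pose colon w : set R := [set r | divides x (r * w)].
have colon_ideal w : is_ideal (colon w).
  split; first by rewrite /colon /= mul0r; exists 0; rewrite mulr0.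
    by move=> a b xa xb; rewrite /colon /= mulrDl; exact: divides_add.
  by move=> a b xb; rewrite /colon /= -mulrA; exact: divides_mull.
pose F := [set colon w | w in [set w | ~ divides x w]].
have [_ [[w xw <-] Pmax]] :
    exists I, F I /\ forall J, F J -> I `<=` J -> J `<=` I.
  apply: (noetherian_maximal noeth (I0 := colon 1)); last by exists 1.
  by move=> _ [w _ <-]; exact: colon_ideal.
have Pprime a b : colon w (a * b) -> ~ colon w a -> colon w b.
  move=> Pab nPa; apply: (Pmax (colon (a * w))); first by exists (a * w).
    by move=> r; rewrite /colon /= mulrCA; exact: divides_mull.
  by rewrite /colon /= mulrA [b * a]mulrC.
have Ppow a k : colon w (a ^+ k) -> colon w a.
  move=> Pa; apply: contrapT => nPa; elim: k Pa => [|k IH].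
    by rewrite /colon /= mul1r.
  by rewrite exprS => /Pprime /(_ nPa).
have comax_notP c : ~ colon w c -> comax x c.
  move=> nPc; have c0 : c != 0.
    by apply/eqP => c0; apply: nPc; rewrite c0; case: (colon_ideal w).
  have [//|[k xc]] := dich c c0; exfalso; apply/nPc/(Ppow _ k).
  by rewrite /colon /=; exact: divides_mulr.
pose pw m y := divides (x ^+ m) (w ^+ m * y).
pose val y m := (forall i, (i <= m)%N -> pw i y) /\ ~ pw m.+1 y.
have val_ex y : y != 0 -> exists m, val y m.
  move=> y0; have [m nm] : exists m, ~ pw m y.
    apply: contrapT => /forallNP all; apply: xw.
    apply: (completely_integrally_closed noeth ic x0 y0) => m.
    exact: contrapT (all m).
  have [[|k] [nk kmin]] := @exists_least (fun m => ~ pw m y) m nm.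
    by exfalso; apply: nk; exists y; rewrite !expr0.
  exists k; split=> // i ik; apply: contrapT => /kmin.
  by rewrite ltnNge ik.
have rad_neq0 y : rad_divides y x -> y != 0.
  move=> [k [r e]]; apply/eqP => y0; move/eqP: e.
  by rewrite y0 mul0r expf_eq0 (negbTE x0) andbF.
have val_div y z m : rad_divides y x -> val y m -> pw m z -> divides y z.
  move=> yx [ym nym] [z' ez].
  have [c ec] := ym m (leqnn m).
  have nPc : ~ colon w c.
    move=> [c' ec']; apply: nym; exists c'.
    by rewrite exprS -mulrA ec mulrCA [w * c]mulrC ec' exprSr mulrA.
  have := comax_radl yx (comax_notP _ nPc).
  move=> yc; apply: (comax_gauss yc); exists z'.
  apply: (mulfI (expf_neq0 m x0)).
  by rewrite mulrA -ec -mulrA [y * z]mulrC mulrA ez; ring.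
have xP : colon w x by exists w.
have nonunitP y : rad_divides y x -> ~ divides y 1 -> colon w y.
  move=> yx y1; apply: contrapT => /comax_notP xy; apply: y1.
  by apply: comax_self; exact: comax_radl yx xy.
have [m0 [[p [px p1 pm]] mmin]] : exists m,
    (exists p, [/\ rad_divides p x, ~ divides p 1 & val p m]) /\
    forall k, (exists p, [/\ rad_divides p x, ~ divides p 1 & val p k]) ->
      (m <= k)%N.
  have [m xm] := val_ex x x0.
  apply: (@exists_least (fun k => exists p,
    [/\ rad_divides p x, ~ divides p 1 & val p k]) m); exists x; split=> //.
  by exists 1%N; exact: divides_refl.
exists p.
have main n z m : (m < n)%N -> rad_divides z x -> val z m ->
    exists s j, z = (-1) ^+ s * p ^+ j.
  elim: n z m => // n IH z m mn zx zm.
  have [z1|z1] := pselect (divides z 1).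
    by have [s ->] := units z z1; exists s, 0%N; rewrite expr0 mulr1.
  have m0m : (m0 <= m)%N by apply: mmin; exists z.
  have [z' ez] : divides p z by apply: val_div px pm _; case: zm => + _; apply.
  have z'x : rad_divides z' x.
    have [k zk] := zx; exists k; apply: divides_trans zk; rewrite ez.
    by exists p; rewrite mulrC.
  have [m' zm'] := val_ex z' (rad_neq0 _ z'x).
  have m'm : (m' < m)%N.
    rewrite ltnNge; apply/negP => mm'; case: zm => _; apply.
    have [r er] := zm'.1 m mm'; have [q eq] := nonunitP p px p1.
    exists (q * r); rewrite ez !exprSr.
    have -> : w ^+ m * w * (p * z') = (p * w) * (w ^+ m * z') by ring.
    by rewrite er eq; ring.
  have [s [j ej]] := IH z' m' (leq_trans m'm mn) z'x zm'.
  by exists s, j.+1; rewrite ez ej exprS; ring.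
move=> z zx; have [m zm] := val_ex z (rad_neq0 _ zx).
exact: (main m.+1 z m).
Qed.

(** * Powers of a prime number in the integers *)

Lemma dividesz (x y : int) : divides x y <-> (x %| y)%Z.
Proof.
split=> [[r ->]|/dvdzP [q ->]]; first exact: dvdz_mulr.
by exists q; rewrite mulrC.
Qed.

(** Two powers of b agree modulo c by the pigeonhole principle. *)
Lemma int_pi_regular : pi_regular_quotients int.
Proof.
move=> b c c0.
have cgt0 : (0 < `|c|)%N by rewrite absz_gt0.
have modlt k : (`|(b ^+ k %% c)%Z| < `|c|)%N.
  by rewrite -ltz_nat gez0_abs ?modz_ge0 // ltz_mod.
pose h (k : 'I_`|c|.+1) : 'I_`|c| := Ordinal (modlt k).
have /injectivePn [i [j ij hij]] : ~~ injectiveb h.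
  apply/negP => /injectiveP /leq_card; rewrite !card_ord; lia.
wlog lt_ij : i j ij hij / (i < j)%N.
  move=> H; have [|ji|e] := ltngtP i j; first exact: H.
    by apply: (H j i) => //; rewrite eq_sym.
  by move/negP: ij; case; apply/eqP/val_inj.
have /eqP eij : (b ^+ i == b ^+ j %[mod c])%Z.
  have := congr1 val hij => /= e.
  by rewrite -(gez0_abs (modz_ge0 (b ^+ i) c0)) e gez0_abs ?modz_ge0.
exists i, (b ^+ (j - i).-1); apply/dividesz.
have -> : b ^+ i * (1 - b * b ^+ (j - i).-1) = b ^+ i - b ^+ j.
  by rewrite -exprS prednK ?subn_gt0 // mulrBr mulr1 -exprD subnKC // ltnW.
by rewrite -eqz_mod_dvd; apply/eqP.
Qed.

Lemma comaxz (x y : int) : comax x y <-> coprimez x y.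
Proof.
split=> [[r [s e]]|/coprimezP [[u v] /= e]].
  by apply/coprimezP; exists (r, s) => /=; rewrite mulrC [s * y]mulrC.
by exists u, v; rewrite mulrC [y * v]mulrC.
Qed.

Lemma prime_dichotomy (l : nat) (z : int) : prime l ->
  comax (l%:Z) z \/ rad_divides (l%:Z) z.
Proof.
move=> lp; have [lz|lz] := boolP (l %| `|z|)%N.
  by right; exists 1%N; rewrite expr1; apply/dividesz; rewrite dvdzE.
by left; apply/comaxz; rewrite coprimezE /= prime_coprime.
Qed.

Lemma divides1z (x : int) : divides x 1 -> x = 1 \/ x = -1.
Proof. by move=> /dividesz; rewrite dvdz1; lia. Qed.

Lemma expr1D (R : comNzRingType) (h : R) n :
  exists q, (1 + h) ^+ n = 1 + n%:R * h + h ^+ 2 * q.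
Proof.
elim: n => [|n [q eq]]; first by exists 0; rewrite expr0; ring.
by exists (n%:R + q + h * q); rewrite exprS eq -natr1; ring.
Qed.

(** The divisibility of c by n^2 makes the quadratic terms negligible, for even
    n as well. *)
Lemma expr1D_expn (R : comNzRingType) (n : nat) (c c' : R) : c = n%:R * n%:R * c' ->
  forall M, exists w, (1 + c) ^+ (n ^ M) = 1 + n%:R ^+ M * c * (1 + n%:R * w).
Proof.
move=> ec; elim=> [|M [w ew]].
  by exists 0; rewrite expn0 expr1 expr0; ring.
rewrite expnSr exprM ew; set h := n%:R ^+ M * c * _.
have [q ->] := expr1D h n.
exists (w + n%:R ^+ M * c' * (1 + n%:R * w) ^+ 2 * q).
have -> : h ^+ 2 = n%:R ^+ M * n%:R ^+ M * c * (n%:R * n%:R * c')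
    * (1 + n%:R * w) ^+ 2.
  by rewrite -ec /h; ring.
by rewrite /h [n%:R ^+ M.+1]exprS; ring.
Qed.

(** The exponent j is refined n-adically: replacing j by j + n^M t changes
    (1 + c)^j by t n^M c modulo c n^(M+1). *)
Lemma powers_dense (n : nat) (c c' : int) : (0 < n)%N -> c = n%:R * n%:R * c' ->
  forall M r, exists j, (0 < j)%N /\
    divides (c * n%:R ^+ M) (1 + c * r - (1 + c) ^+ j).
Proof.
move=> n0 ec; elim=> [|M IH] r.
  by exists 1%N; split=> //; rewrite expr0 expr1; exists (r - 1); ring.
have [j [j0 [s es]]] := IH r.
have [w ew] := expr1D_expn ec M.
pose t := `|(s %% n)%Z|%N.
have nz0 : n%:Z != 0 by lia.
have [v ev] : exists v, s = t%:R + n%:R * v.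
  exists (s %/ n)%Z; have := divz_eq s n.
  rewrite -[LHS]/s /t natz gez0_abs ?modz_ge0 // => {1}->.
  by rewrite natz; ring.
exists (j + n ^ M * t)%N; split; first by rewrite addn_gt0 j0.
rewrite exprD [(1 + c) ^+ (n ^ M * t)]exprM ew.
set x := n%:R ^+ M * c * (1 + n%:R * w).
have [q ->] := expr1D x t.
have [G eG] : exists G, G = (1 + c) ^+ j by exists ((1 + c) ^+ j).
rewrite -eG in es *.
have eG' : G = 1 + n%:R * (n%:R * c' * (r - n%:R ^+ M * s)).
  transitivity (1 + c * r - c * n%:R ^+ M * s); first by rewrite -es; ring.
  by rewrite ec; ring.
set A := n%:R * c' * _ in eG'.
exists (v - A * t%:R
  - G * (t%:R * w + n%:R * c' * n%:R ^+ M * (1 + n%:R * w) ^+ 2 * q)).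
transitivity (c * n%:R ^+ M * s - G * (t%:R * x + x ^+ 2 * q)).
  by rewrite -es; ring.
have -> : x ^+ 2 = c * n%:R ^+ M
    * (n%:R * n%:R * c' * n%:R ^+ M * (1 + n%:R * w) ^+ 2).
  by rewrite -ec /x; ring.
rewrite /x [n%:R ^+ M.+1]exprS.
transitivity (c * n%:R ^+ M * (s - G * t%:R - n%:R
  * (G * (t%:R * w + n%:R * c' * n%:R ^+ M * (1 + n%:R * w) ^+ 2 * q)))).
  by ring.
by rewrite ev {1}eG'; ring.
Qed.

(** By Euler's theorem c = l^phi - 1 is a multiple of n^2, where phi is the
    totient of n^2.  The powers of l^phi are dense in 1 + cZ for the moduli
    c n^N; since c may have prime factors foreign to n, the exponent e is taken
    so that n^e lies in cZ + n^N Z for all N. *)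
Lemma powers_adic_neighborhood (n l : nat) :
  (0 < n)%N -> (1 < l)%N -> coprime l n ->
  exists e, forall N (r : int), exists j, (0 < j)%N /\
    divides (n%:R ^+ N) (1 + n%:R ^+ e * r - l%:R ^+ j : int).
Proof.
move=> n0 l1 ln.
have phi0 : (0 < totient (n * n))%N by rewrite totient_gt0 muln_gt0 n0.
have [c' ec] : exists c' : int, l%:R ^+ totient (n * n) - 1 = n%:R * n%:R * c'.
  have /eqP : l ^ totient (n * n) = 1 %[mod n * n].
    by apply: Euler_exp_totient; rewrite coprimeMr ln.
  rewrite eqn_mod_dvd ?expn_gt0 ?(ltnW l1) // => /dvdnP [q eq]; exists q%:R.
  rewrite -natrX -[1]/(1%:R) -natrB ?expn_gt0 ?(ltnW l1) // eq !natrM; ring.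
set c := _ - 1 in ec.
have c0 : c != 0.
  rewrite /c subr_eq0 -natrX -[1]/(1%:R) Num.Theory.eqr_nat; apply/eqP.
  by have := ltn_exp2l 0 (totient (n * n)) l1; rewrite phi0; lia.
have [i [t [u eu]]] := int_pi_regular n%:R c0.
exists i => N r.
have [v [v' ev]] : exists v v', n%:R ^+ i = c * v + n%:R ^+ N * v'.
  have [S eS] := divides_1subX (n%:R * t) N.
  exists (u * S), (t ^+ N * n%:R ^+ i).
  transitivity (n%:R ^+ i * ((1 - n%:R * t) * S) + n%:R ^+ N * t ^+ N * n%:R ^+ i).
    by rewrite -eS exprMn; ring.
  by rewrite mulrA eu mulrA; ring.
have [j [j0 [q eq]]] := powers_dense n0 ec N (v * r).
exists (totient (n * n) * j)%N; split; first by rewrite muln_gt0 phi0.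
rewrite exprM; exists (v' * r + c * q).
have -> : l%:R ^+ totient (n * n) = 1 + c by rewrite /c; ring.
rewrite ev; transitivity ((1 + c * (v * r) - (1 + c) ^+ j) + n%:R ^+ N * v' * r).
  by ring.
by rewrite eq; ring.
Qed.

(** * Residue rings at prime numbers *)

Section NatDivides.
Variable R : comNzRingType.

Lemma coprime_comax (m n : nat) : coprime m n -> comax (m%:R : R) n%:R.
Proof.
move=> mn; have [r [s e]] : comax (m%:Z) n%:Z by apply/comaxz; rewrite coprimezE.
exists r%:~R, s%:~R.
by have := congr1 (intr : int -> R) e; rewrite intrD !intrM.
Qed.

Lemma divides_natr_dvdn (p m : nat) : prime p -> ~ divides (p%:R : R) 1 ->
  divides (p%:R : R) m%:R -> (p %| m)%N.
Proof.
move=> pp p1 pm; apply: contrapT => npm; apply: p1; apply: comax_self.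
have pm' : comax (p%:R : R) m%:R.
  by apply: coprime_comax; rewrite prime_coprime //; apply/negP.
by apply: comaxC; apply: comax_divl pm (comaxC pm').
Qed.

Lemma mod_prime_integer (p t m : nat) (r : R) : prime p -> ~ (p %| t)%N ->
  divides p%:R (t%:R * r - m%:R) -> exists i : int, divides p%:R (r - i%:~R).
Proof.
move=> pp pt [q eq].
have [a [b e]] : comax (p%:Z) t%:Z.
  by apply/comaxz; rewrite coprimezE /= prime_coprime //; apply/negP.
exists (b * m%:Z); exists (a%:~R * r + b%:~R * q).
have e' : p%:R * a%:~R + t%:R * b%:~R = 1 :> R.
  by have := congr1 (intr : int -> R) e; rewrite intrD !intrM.
rewrite intrM -[m%:~R]/(m%:R).
transitivity ((p%:R * a%:~R + t%:R * b%:~R) * r - b%:~R * m%:R).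
  by rewrite e' mul1r.
transitivity (p%:R * a%:~R * r + b%:~R * (t%:R * r - m%:R)); first ring.
by rewrite eq; ring.
Qed.

End NatDivides.

(** Let d be the order of x modulo P = p^e and x^d = 1 + P y.  The squares of
    1 + P r and its approximation satisfy 1 + 2 P r = x^(d q) = 1 + q P y modulo
    P^2, so that 2 r = q y modulo P.  Comparison with the case r = 1 eliminates
    y, at once for odd p, and after halving the congruences for p = 2; this is
    why e is at least 2. *)
Lemma adic_powers_residues (R : idomainType) (p : nat) (x : R) (k : nat) :
  prime p -> (p%:R : R) != 0 -> ~ divides (p%:R : R) 1 ->
  (forall N (r : R), exists s j, (0 < j)%N /\
     divides (p%:R ^+ N) (1 + p%:R ^+ k * r - (-1) ^+ s * x ^+ j)) ->
  forall r : R, exists i : int, divides p%:R (r - i%:~R).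
Proof.
move=> pp p0 p1 dense.
pose e := (k + 2)%N; pose P : R := p%:R ^+ e.
have ek : P = p%:R ^+ k * p%:R ^+ 2 by rewrite /P exprD.
have P0 : P != 0 by rewrite expf_neq0.
have sq N r : exists j, (0 < j)%N /\
    divides (p%:R ^+ N) ((1 + P * r) ^+ 2 - x ^+ j).
  have [s [j [j0 dj]]] := dense N (p%:R ^+ 2 * r).
  exists (j * 2)%N; split; first by rewrite muln_gt0 j0.
  have := divides_subX 2 (y := 1 + P * r) (z := (-1) ^+ s * x ^+ j)
    (x := p%:R ^+ N).
  rewrite exprMn sqrr_sign mul1r -exprM; apply.
  by rewrite ek -mulrA.
have [d [[d0 [y ey]] dmin]] : exists d,
    ((0 < d)%N /\ exists y, x ^+ d = 1 + P * y) /\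
    forall d', ((0 < d')%N /\ exists y, x ^+ d' = 1 + P * y) -> (d <= d')%N.
  have [j [j0 [q eq]]] := sq e 0.
  apply: (@exists_least (fun d => (0 < d)%N /\ exists y, x ^+ d = 1 + P * y) j).
  split=> //; exists (- q); rewrite mulrN -eq mulr0; ring.
have lin r : exists q : nat, divides P (2%:R * r - q%:R * y).
  have [j [j0 [u eu]]] := sq (e * 2)%N r.
  have xj : x ^+ j = 1 + P * (2%:R * r + P * r ^+ 2 - P * u).
    transitivity ((1 + P * r) ^+ 2 - ((1 + P * r) ^+ 2 - x ^+ j)); first by ring.
    by rewrite eu exprM -/P; ring.
  have [q [s [sd ejq]]] : exists q s, (s < d)%N /\ j = (d * q + s)%N.
    by exists (j %/ d)%N, (j %% d)%N; rewrite ltn_pmod // mulnC -divn_eq.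
  have [v ev] := expr1D (P * y) q.
  have xdq : x ^+ (d * q) = 1 + P * (q%:R * y + P * y ^+ 2 * v).
    by rewrite exprM ey ev; ring.
  have s0 : s = 0%N.
    apply/eqP; rewrite -leqn0 leqNgt; apply/negP => s_gt0.
    suff /dmin : (0 < s)%N /\ exists y, x ^+ s = 1 + P * y by rewrite leqNgt sd.
    split=> //.
    exists (2%:R * r + P * r ^+ 2 - P * u
      - x ^+ s * (q%:R * y + P * y ^+ 2 * v)).
    move: xj; rewrite ejq exprD xdq.
    set A := q%:R * y + _; set B := 2%:R * r + _ - _ => eAB.
    transitivity ((1 + P * A) * x ^+ s - P * (x ^+ s * A)); first by ring.
    by rewrite eAB; ring.
  exists q, (y ^+ 2 * v - r ^+ 2 + u).
  apply: (mulfI P0); move: xj; rewrite ejq s0 addn0 xdq => /addrI eP.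
  transitivity (P * (2%:R * r + P * r ^+ 2 - P * u)
    - P * (P * r ^+ 2 - P * u + q%:R * y)).
    by ring.
  by rewrite -eP; ring.
have pP : divides (p%:R ^+ 2) P by exists (p%:R ^+ k); rewrite ek mulrC.
have pp2 : divides (p%:R : R) (p%:R ^+ 2) by exists p%:R.
have [q1 /(divides_trans pP) y1] := lin 1.
move=> r; have [q /(divides_trans pP) yr] := lin r.
have comb : divides (p%:R ^+ 2) (2%:R * (q1%:R * r - q%:R)).
  have -> : 2%:R * (q1%:R * r - q%:R) =
      q1%:R * (2%:R * r - q%:R * y) - q%:R * (2%:R * 1 - q1%:R * y) by ring.
  by apply: divides_sub; exact: divides_mull.
have [p2|p_odd] := eqVneq p 2%N; last first.
  apply: (@mod_prime_integer _ p (2 * q1) (2 * q)) => //.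
    rewrite Euclid_dvdM // => /orP[p2|pq1].
      by move: p_odd; rewrite -(dvdn_prime2 pp (isT : prime 2)) p2.
    have p2 : (p %| 2)%N.
      apply: (divides_natr_dvdn pp p1); rewrite -[2%:R]mulr1.
      rewrite -[_ * 1](subrK (q1%:R * y)); apply: divides_add.
        exact: divides_trans y1.
      apply: divides_mulr; have /dvdnP [z ->] := pq1.
      by rewrite natrM; apply: divides_mull; exact: divides_refl.
    by move: p_odd; rewrite -(dvdn_prime2 pp (isT : prime 2)) p2.
  have -> : (2 * q1)%:R * r - (2 * q)%:R = 2%:R * (q1%:R * r - q%:R).
    by rewrite !natrM; ring.
  exact: divides_trans comb.
have half z : divides (p%:R ^+ 2) (2%:R * z) -> divides (p%:R : R) z.
  move=> [w ew]; exists w; apply: (mulfI p0).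
  by rewrite mulrA -[X in _ = X * w]expr2 -ew p2.
have [pq1|/negP pq1] := boolP (p %| q1)%N; last first.
  by apply: (mod_prime_integer pp pq1); exact: half comb.
have /dvdnP [h1 eh1] := pq1; rewrite p2 in eh1.
have h1y : divides (p%:R : R) (1 - h1%:R * y).
  apply: half; move: y1; rewrite eh1 natrM.
  by have -> : 2%:R * 1 - h1%:R * 2%:R * y = 2%:R * (1 - h1%:R * y) by ring.
have ph1 : ~ (p %| h1)%N.
  move=> /dvdnP [z ez]; apply: p1; rewrite -[X in divides _ X](subrK (h1%:R * y)).
  apply: divides_add => //; apply: divides_mulr; rewrite ez natrM.
  by apply: divides_mull; exact: divides_refl.
have pq : (p %| q)%N.
  apply: (divides_natr_dvdn pp p1).
  have -> : q%:R = q%:R * (1 - h1%:R * y) - h1%:R * (2%:R * r - q%:R * y)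
      + 2%:R * (h1%:R * r) by ring.
  apply: divides_add; last by rewrite -p2; apply: divides_mulr; exact: divides_refl.
  by apply: divides_sub; apply: divides_mull => //; exact: divides_trans yr.
have /dvdnP [h eh] := pq; rewrite p2 in eh.
have ry : divides (p%:R : R) (r - h%:R * y).
  apply: half; move: yr; rewrite eh natrM.
  by have -> : 2%:R * r - h%:R * 2%:R * y = 2%:R * (r - h%:R * y) by ring.
apply: (@mod_prime_integer _ p h1 h) => //.
have -> : h1%:R * r - h%:R =
  h1%:R * (r - h%:R * y) - h%:R * (1 - h1%:R * y) by ring.
by apply: divides_sub; exact: divides_mull.
Qed.

(** After removing powers of the variable, the constant term of an integral
    equation satisfied by r is a nonzero multiple of r. *)
Lemma algebraic_divides_int (R : idomainType) (q : {poly int}) (r : R) :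
  (forall n : int, n != 0 -> (n%:~R : R) != 0) -> q != 0 -> r != 0 ->
  root (map_poly (intr : int -> R) q) r ->
  exists2 c : int, c != 0 & divides r c%:~R.
Proof.
move=> char0 + r0; elim/poly_ind: q => [|q c IH]; first by rewrite eqxx.
move=> q0 /rootP; rewrite rmorphD rmorphM /= map_polyX map_polyC !hornerE.
have [c0|c0] := eqVneq c 0.
  rewrite c0 addr0 => /eqP; rewrite mulf_eq0 (negbTE r0) orbF => qr.
  apply: IH => //; apply: contraNneq q0 => ->.
  by rewrite c0 mul0r add0r.
move=> e; exists c => //; exists (- (map_poly intr q).[r]).
by apply/eqP; rewrite -subr_eq0 mulrN opprK mulrC addrC; apply/eqP.
Qed.

(** Each prime number p is a prime element, as R = Z + pR.  A prime
    factor p of c = r s thus divides r or s, and it can be removed from c and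
    from that factor. *)
Lemma divisors_of_integers (R : idomainType) (r : R) (c : nat) :
  (forall n : nat, (0 < n)%N -> (n%:R : R) != 0) ->
  (forall u : R, divides u 1 -> exists s : nat, u = (-1) ^+ s) ->
  (forall (p : nat) (x : R), prime p -> exists i : int, divides p%:R (x - i%:~R)) ->
  (0 < c)%N -> divides r c%:R -> exists i : int, r = i%:~R.
Proof.
move=> char0 units res; have [n] := ubnP c; elim: n c r => // n IH c r cn c0 [s es].
have [c1|c1] := leqP c 1.
  have [k ->] : exists k : nat, r = (-1) ^+ k.
    by apply: units; exists s; rewrite -es (_ : c = 1%N) //; lia.
  by exists ((-1) ^+ k); rewrite rmorphXn /= rmorphN1.
have [p pp pc] := pdivP c1.
have dich (x : R) : divides p%:R x \/ comax p%:R x.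
  have [i [q eq]] := res p x pp.
  have [/dvdzP [m ei]|pi] := boolP (p%:Z %| i)%Z.
    left; exists (q + m%:~R); rewrite mulrDr -eq ei intrM -[p%:~R]/(p%:R); ring.
  right; have [a [b e]] : comax (p%:Z) i.
    by apply/comaxz; rewrite coprimezE /= prime_coprime.
  have e' : p%:R * a%:~R + i%:~R * b%:~R = 1 :> R.
    by have := congr1 (intr : int -> R) e; rewrite intrD !intrM.
  exists (a%:~R - q * b%:~R), b%:~R; rewrite -[RHS]e'.
  have -> : x = (x - i%:~R) + i%:~R by rewrite subrK.
  by rewrite eq; ring.
have /dvdnP [c' ec'] := pc.
have p0 : (p%:R : R) != 0 by apply: char0; exact: prime_gt0.
have c'0 : (0 < c')%N by lia.
have c'n : (c' < n)%N by have := prime_gt1 pp; nia.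
have [[r' er]|pr] := dich r.
  have [i ei] : exists i : int, r' = i%:~R.
    apply: (IH c') => //; exists s; apply: (mulfI p0).
    by rewrite mulrA -er -es ec' natrM mulrC.
  by exists (p%:Z * i); rewrite er ei intrM.
have [s' es'] : divides p%:R s.
  apply: (comax_gauss pr); rewrite -es ec' natrM.
  by apply: divides_mull; exact: divides_refl.
apply: (IH c') => //; exists s'; apply: (mulfI p0).
by rewrite mulrCA -es' -es ec' natrM mulrC.
Qed.

(** * Domains with the Golomb space of the integers *)

Section HomeomorphicToZ.
Variables (R : idomainType).
Variables (f : golomb R -> golomb int) (g : golomb int -> golomb R).
Hypotheses (noeth : noetherian R) (ic : integrally_closed R).
Hypothesis regR : pi_regular_quotients R.
Hypothesis char0 : forall n : int, n != 0 -> (n%:~R : R) != 0.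
Hypotheses (cf : continuous f) (cg : continuous g).
Hypotheses (fK : cancel f g) (gK : cancel g f).

Let twoR : (2%:R : R) != 0. Proof. exact: (char0 (n := 2)). Qed.
Let twoZ : (2%:R : int) != 0. Proof. by []. Qed.

Let f_unit := homeo_unit regR int_pi_regular twoR twoZ cf cg fK gK.
Let g_unit := homeo_unit int_pi_regular regR twoZ twoR cg cf gK fK.
Let g_rad := homeo_rad_divides int_pi_regular regR twoZ twoR cg cf gK fK.
Let f_comax := homeo_comax regR int_pi_regular twoR twoZ cf cg fK gK.
Let g_comax := homeo_comax int_pi_regular regR twoZ twoR cg cf gK fK.

Lemma units_homeomorphic_Z (u : R) : divides u 1 -> exists s : nat, u = (-1) ^+ s.
Proof.
move=> u1; have u0 : u != 0.
  apply/eqP => u0; have [r /eqP] := u1.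
  by rewrite u0 mul0r oner_eq0.
have m1 : (-1 : R) != 0 by rewrite oppr_eq0 oner_neq0.
pose one := golomb_point (oner_neq0 R).
pose mone := golomb_point m1.
pose U := golomb_point u0.
have one_mone : one <> mone.
  by move=> /(congr1 val) /= /eqP; rewrite -subr_eq0 opprK (negbTE twoR).
have f1 : divides (\val (f one)) 1 by apply: f_unit; exact: divides_refl.
have fm1 : divides (\val (f mone)) 1.
  by apply: f_unit; exists (-1); rewrite mulrNN mulr1.
have fU : divides (\val (f U)) 1 by exact: f_unit.
have inj x y : \val (f x) = \val (f y) -> x = y by move=> /golomb_inj /(can_inj fK).
suff [/inj /(congr1 val) /= ->|/inj /(congr1 val) /= ->] :
    \val (f U) = \val (f one) \/ \val (f U) = \val (f mone).
- by exists 0%N.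
- by exists 1%N.
have : \val (f one) <> \val (f mone) by move=> /inj.
case: (divides1z f1) => ->; case: (divides1z fm1) => ->;
  case: (divides1z fU) => -> ne; by [exfalso; exact: ne | left | right].
Qed.

Lemma prime_nonunit (p : nat) : (1 < p)%N -> ~ divides (p%:R : R) 1.
Proof.
move=> p1 /units_homeomorphic_Z [s]; rewrite -signr_odd => /eqP e.
have : ((p%:Z - (-1) ^+ odd s)%:~R : R) = 0.
  by rewrite intrB rmorphXn /= rmorphN1; apply/eqP; rewrite subr_eq0.
by apply/eqP/char0; case: (odd s); rewrite ?expr1 ?expr0; lia.
Qed.

(** The density of the powers of l near h(1) is transported twice: first the
    clopen set h(1) + m^(e+1) Z, in which these powers are dense up to sign, is
    pulled back to find p^(k+1); then, for each N, the clopen set z + p^(N+1) R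
    is pushed forward to find the precision needed in Z. *)
Lemma adic_powers_homeomorphic_Z (p : nat) : prime p -> exists (x : R) k,
  forall N (r : R), exists s j, (0 < j)%N /\
    divides (p%:R ^+ N) (1 + p%:R ^+ k * r - (-1) ^+ s * x ^+ j).
Proof.
move=> pp; have p1 := prime_nonunit (prime_gt1 pp).
have p0 : (p%:R : R) != 0.
  by apply: (char0 (n := p%:Z)); have := prime_gt0 pp; lia.
pose P := golomb_point p0; pose one := golomb_point (oner_neq0 R).
have [m em] : exists m, m = `|\val (f P)|%N by exists `|\val (f P)|%N.
have m_gt0 : (0 < m)%N by rewrite em absz_gt0 golomb_neq0.
have mP (z : int) : comax (\val (f P)) z <-> comax (m%:R : int) z.
  apply: iff_trans (comaxz _ _) _; apply: iff_sym; apply: iff_trans (comaxz _ _) _.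
  by rewrite natz !coprimezE em.
have P_m (z : golomb R) : comax p%:R (\val z) <-> comax (m%:R : int) (\val (f z)).
  split=> [pz|/mP mz]; first by apply/mP; exact: (f_comax (x := P)).
  by have := g_comax mz; rewrite !fK.
have m0 : (m%:R : int) != 0 by rewrite natz; lia.
have m1 : ~ divides (m%:R : int) 1.
  move=> /(divides1_comax (\val (f P))) /mP /comax_self /g_unit.
  by rewrite fK.
have [l l_m lp] := prime_above m.
have l_co : coprime l m by rewrite prime_coprime // gtnNdvd.
have l0 : (l%:Z : int) != 0 by have := prime_gt0 lp; lia.
pose L : golomb int := golomb_point l0.
have gL1 : ~ divides (\val (g L)) 1.
  move=> /f_unit; rewrite gK /= => /dividesz.
  by have := prime_gt1 lp; rewrite dvdz1 /=; lia.
have dich z : z != 0 -> comax (\val (g L)) z \/ rad_divides (\val (g L)) z.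
  move=> z0; have := prime_dichotomy (\val (f (golomb_point z0))) lp.
  by move=> [/(g_comax (x := L))|/(g_rad (x := L))]; rewrite fK; [left|right].
have [x xpow] := radical_atom_powers noeth ic units_homeomorphic_Z
  (golomb_neq0 (g L)) gL1 dich.
have [e edense] := powers_adic_neighborhood m_gt0 (prime_gt1 lp) l_co.
have u1 : divides (\val (f one)) 1 by apply: f_unit; exact: divides_refl.
have uu : \val (f one) * \val (f one) = 1 by have [->|->] := divides1z u1.
(* The exponents e + 1 and N + 1 below are positive so that the cosets stay
   inside the elements coprime to m and to p. *)
pose SZ := coset (\val (f one)) (m%:R ^+ e.+1 : int).
have m_u : comax (m%:R : int) (\val (f one)) by exact/comaxC/divides1_comax.
have oSZ : open SZ by exact: open_coprime_adic.
have oSZc : open (coprime_to (m%:R : int) `\` SZ) by exact: open_coprime_coset_compl.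
have SZm : SZ `<=` coprime_to (m%:R : int).
  move=> z [q zq]; apply: (comax_coset m_u); rewrite /coset /= zq exprS -mulrA.
  by apply: divides_mulr; exact: divides_refl.
have preim A : coprime_to (p%:R : R) `\` f @^-1` A =
    f @^-1` (coprime_to (m%:R : int) `\` A).
  by apply/seteqP; split=> z [/P_m zm nA].
have [k kS] : exists k, coset (\val one) (p%:R ^+ k) `<=` f @^-1` SZ.
  apply: (clopen_coprime_adic regR p0 p1 (S := f @^-1` SZ)).
  - by move=> z /SZm /P_m.
  - by move/continuousP: cf; apply.
  - by rewrite preim; move/continuousP: cf; apply.
  - exact: coset_refl.
exists x, k.+1 => N r.
have pk : divides (p%:R : R) (p%:R ^+ k.+1 * r).
  by rewrite exprS -mulrA; apply: divides_mulr; exact: divides_refl.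
have pz1 : comax (p%:R : R) (1 + p%:R ^+ k.+1 * r).
  by apply: (comax_cong _ (comax1 _)); rewrite opprD addNKr; exact: divides_opp.
have z0 : 1 + p%:R ^+ k.+1 * r != 0.
  by apply/eqP => z0; apply: p1; move: pz1 => [a [b]]; rewrite z0 mul0r addr0; exists a.
pose z : golomb R := golomb_point z0.
have [q eq] : SZ (f z).
  apply: kS; exists (p%:R * r); rewrite /= exprSr; ring.
have [k' k'S] : exists k', coset (\val (f z)) (m%:R ^+ k' : int)
    `<=` g @^-1` (coset (\val z) (p%:R ^+ N.+1)).
  apply: (clopen_coprime_adic int_pi_regular m0 m1).
  - move=> w wz; rewrite /coprime_to /= -(gK w); apply/P_m.
    apply: (comax_coset (x := z) pz1); apply: divides_trans wz; rewrite exprS.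
    by apply: divides_mulr; exact: divides_refl.
  - by move/continuousP: cg; apply; exact: open_coprime_adic.
  - have -> : coprime_to (m%:R : int) `\` g @^-1` coset (\val z) (p%:R ^+ N.+1) =
        g @^-1` (coprime_to (p%:R : R) `\` coset (\val z) (p%:R ^+ N.+1)).
      have gm (w : golomb int) :
          comax (m%:R : int) (\val w) <-> comax p%:R (\val (g w)).
        by apply: iff_sym; rewrite -{2}(gK w); exact: P_m.
      by apply/seteqP; split=> w [/gm wm nw].
    by move/continuousP: cg; apply; exact: open_coprime_coset_compl.
  - by rewrite /preimage /= fK; exact: coset_refl.
have [j [j0 [t et]]] := edense k' (m%:R * \val (f one) * q).
have W0 : \val (f one) * l%:R ^+ j != 0.
  by rewrite mulf_neq0 ?golomb_neq0 // expf_neq0 // natz.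
pose W : golomb int := golomb_point W0.
have WS : coset (\val z) (p%:R ^+ N.+1) (g W).
  apply: k'S; exists (- (\val (f one) * t)).
  have -> : \val (f z) = \val (f one) + m%:R ^+ e.+1 * q by rewrite -eq addrC subrK.
  rewrite /= mulrN mulrCA -et exprS.
  transitivity (\val (f one) * l%:R ^+ j - \val (f one)
      - (\val (f one) * \val (f one)) * (m%:R * m%:R ^+ e * q)); last by ring.
  by rewrite uu; ring.
have [s [j' eW]] : exists s j', \val (g W) = (-1) ^+ s * x ^+ j'.
  apply: xpow; apply: g_rad; exists j; exists (\val (f one)).
  by rewrite /= mulrAC uu mul1r natz.
exists s, j'; split.
  rewrite lt0n; apply/negP => /eqP j'0.
  have : divides (\val (f (g W))) 1.
    apply: f_unit; rewrite eW j'0 expr0 mulr1; exists ((-1) ^+ s).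
    by rewrite -expr2 sqrr_sign.
  rewrite gK /= => /dividesz; rewrite dvdz1 abszM abszX natz /=.
  rewrite muln_eq1 => /andP[_ /eqP lj1].
  by have := ltn_exp2l 0 j (prime_gt1 lp); rewrite lj1 j0.
apply: divides_subC; rewrite -eW; apply: divides_trans WS.
exact: divides_pow_le.
Qed.

Lemma integers_homeomorphic_Z (r : R) (c : int) :
  c != 0 -> divides r c%:~R -> exists i : int, r = i%:~R.
Proof.
move=> c0 rc; apply: (divisors_of_integers (c := `|c|%N)) => //.
- by move=> n n0; apply: (char0 (n := n%:Z)); lia.
- exact: units_homeomorphic_Z.
- move=> p x pp; have [y [k dense]] := adic_powers_homeomorphic_Z pp.
  apply: (adic_powers_residues pp _ _ dense); last first.
    exact: prime_nonunit (prime_gt1 pp).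
  by apply: (char0 (n := p%:Z)); have := prime_gt0 pp; lia.
- by rewrite absz_gt0.
have -> : (`|c|%N%:R : R) = (`|c|%N%:Z)%:~R by [].
rewrite abszE; case: (Num.Theory.ger0P c) => _; first exact: rc.
by rewrite rmorphN; exact: divides_opp.
Qed.

End HomeomorphicToZ.

(* K is an extension of Q via [j]; R is identified with the subring
   [range iota] of K, and R = Z is an equality of subrings of K. *)
Theorem theorem6p8 (K : fieldType) (j : {rmorphism rat -> K})
    (K_alg : forall x : K, algebraicOver j x)
    (R : idomainType) (iota : {rmorphism R -> K})
    (iota_inj : injective iota)
    (K_frac : forall x : K, exists a b : R, b != 0 /\ x = iota a / iota b)
    (R_ded : dedekind_domain R)
    (hom : homeomorphic (golomb R) (golomb int)) :
  range iota = range (fun n : int => n%:~R : K).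
Proof.
have [dim1 noeth ic] := R_ded.
have [f [g [cf cg fK gK]]] := hom.
have regR := dimension1_pi_regular noeth dim1.
have char0 (n : int) : n != 0 -> (n%:~R : R) != 0.
  move=> n0; apply/eqP => /(congr1 iota); rewrite rmorph_int rmorph0 -(rmorph_int j).
  by move/eqP; rewrite fmorph_eq0 intr_eq0 (negbTE n0).
suff all_int (r : R) : exists i : int, r = i%:~R.
  apply/seteqP; split=> [_ [r _ <-]|_ [i _ <-]].
    by have [i ->] := all_int r; exists i; rewrite ?rmorph_int.
  by exists i%:~R; rewrite ?rmorph_int.
have [->|r0] := eqVneq r 0; first by exists 0.
have [p p0 pr] := K_alg (iota r).
have [q [a a0 ep]] := rat_poly_scale p.
have q0 : q != 0 by apply: contraNneq p0 => q0; rewrite ep q0 rmorph0 scaler0.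
have qr : root (map_poly (intr : int -> R) q) r.
  move: pr; rewrite ep map_polyZ rootZ; last first.
    by rewrite fmorph_eq0 invr_eq0 intr_eq0.
  rewrite -map_poly_comp (eq_map_poly (g := iota \o intr)); last first.
    by move=> n /=; rewrite !rmorph_int.
  rewrite map_poly_comp => /rootP; rewrite horner_map -(rmorph0 iota).
  by move=> /iota_inj /rootP.
have [c c0 rc] := algebraic_divides_int char0 q0 r0 qr.
exact: (integers_homeomorphic_Z noeth ic regR char0 cf cg fK gK c0 rc).
Qed.
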